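(* Let $p>3$ be a prime and let $G=\langle a_1,a_2,a_3,a_4\mid [a_2,a_1]=a_3,\ [a_3,a_1]=a_4\rangle$ (with the trivial relations omitted). Then every automorphism $\alpha$ of $G$ can be written uniquely as $\alpha=\alpha(u_1,u_2,u_3,u_4,v_2,v_3,v_4)$, where $$a_1\mapsto a_1^{u_1}a_2^{u_2}a_3^{u_3}a_4^{u_4},\quad a_2\mapsto a_2^{v_2}a_3^{v_3}a_4^{v_4},\quad a_3\mapsto a_3^{u_1v_2}a_4^{u_1v_3+u_1(u_1-1)v_2/2},\quad a_4\mapsto a_4^{u_1^2v_2},$$ with $u_1,u_2,u_3,u_4,v_2,v_3,v_4\in\{0,\dots,p-1\}$ and $u_1v_2\neq 0$ in $\mathbb F_p$.
   Context: $[h,g]=h^{-1}g^{-1}hg$. Presentation convention: $G$ is defined by the power-commutator presentation with the displayed relations together with all omitted trivial relations: $a_i^p=1$ for $i=1,\dots,4$ and $[a_j,a_i]=1$ for every pair $j>i$ for which no relation with left-hand side $[a_j,a_i]$ is displayed. So $G$ has order $p^4$. *)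

(* Defs.v *)
From HB Require Import structures.
From mathcomp Require Import all_boot all_order all_algebra all_fingroup.

Set Implicit Arguments.
Unset Strict Implicit.
Unset Printing Implicit Defensive.

Import GroupScope.

Section Presentation.

Variables (p : nat) (gT : finGroupType).

(* [~ x, y] is x^-1 * y^-1 * x * y. *)
Definition rels (a1 a2 a3 a4 : gT) : Prop :=
  [/\ [/\ a1 ^+ p = 1, a2 ^+ p = 1, a3 ^+ p = 1 & a4 ^+ p = 1],
      [~ a2, a1] = a3,
      [~ a3, a1] = a4 &
      [/\ [~ a4, a1] = 1, [~ a3, a2] = 1, [~ a4, a2] = 1 & [~ a4, a3] = 1]].

(* The isomorphism with the presented group, as stated by Grp, does not name  *)
(* the images of the generators, so they are given explicitly.  As G is       *)
(* finite, every generating quadruple satisfying the relations is the image   *)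
(* of the generators of the presentation under some isomorphism.              *)
Definition presented_by (G : {group gT}) (a1 a2 a3 a4 : gT) : Prop :=
  [/\ G \isog Grp (x1 : x2 : x3 : x4 :
        x1 ^+ p, x2 ^+ p, x3 ^+ p, x4 ^+ p,
        [~ x2, x1] = x3, [~ x3, x1] = x4,
        [~ x4, x1], [~ x3, x2], [~ x4, x2], [~ x4, x3]),
      <<[set a1; a2; a3; a4]>> = G &
      rels a1 a2 a3 a4].

(* Both the truncated predecessor and the division by 2 are exact here:       *)
(* u1 * (u1 - 1) is even, and it is 0 when u1 = 0.                            *)
Definition is_alpha (a1 a2 a3 a4 : gT) (u1 u2 u3 u4 v2 v3 v4 : nat)
    (alpha : gT -> gT) : Prop :=
  [/\ alpha a1 = a1 ^+ u1 * a2 ^+ u2 * a3 ^+ u3 * a4 ^+ u4,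
      alpha a2 = a2 ^+ v2 * a3 ^+ v3 * a4 ^+ v4,
      alpha a3 = a3 ^+ (u1 * v2)%N *
                 a4 ^+ (u1 * v3 + (u1 * (u1 - 1) * v2) %/ 2)%N &
      alpha a4 = a4 ^+ (u1 ^ 2 * v2)%N].

End Presentation.

(* Main.v *)
Require Import Defs.
From HB Require Import structures.
From mathcomp Require Import all_boot all_order all_algebra all_fingroup.
From mathcomp Require Import cyclic commutator ring.

Set Implicit Arguments.
Unset Strict Implicit.
Unset Printing Implicit Defensive.

Import GroupScope.

(** The elements a2, a3, a4 commute, and a1 acts on the abelian subgroup they
    generate by a2 -> a2 a3, a3 -> a3 a4, a4 -> a4.  Iterating this unipotent
    action u times produces the binomial coefficients 1, u, 'C(u, 2), so that
    every commutator with an element whose a1-exponent is u has a closed form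
    [comm_mono3].  The formula for alpha a3 is this closed form applied to
    a3 = [~ a2, a1], and the formula for alpha a4 comes from a4 = [~ a3, a1].

    What must be shown is that alpha a2 has a1-exponent w = 0.  The commutator
    alpha a3 of alpha a2 and alpha a1 has the form a3 ^+ j * a4 ^+ k
    [commutator_mono3].  It commutes with alpha a2, and their commutator is
    a4 ^+ (w * j), so p divides w * j.  If p divided j, then alpha a3 would be
    central and alpha a4 = [~ alpha a3, alpha a1] would be trivial.  Hence
    w = 0, and then u1 * v2 is nonzero mod p because
    alpha a4 = a4 ^+ (u1 ^ 2 * v2) is nontrivial.

    Both this argument and the uniqueness of normal forms [normal_form_inj]
    rest only on a4 != 1, since the exponents of an element are read off as
    powers of a4 by taking commutators with a1 and a3.  That a4 != 1 is the one
    fact that needs the universal property of the presentation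
    [presented_a4_neq1]: some group satisfying the relations, here a group of
    permutations of the plane over 'F_p, has nilpotency class 3, whereas G
    would have class at most 2 if a4 were trivial. *)

(** * Normal forms and commutators *)

Section Relations.

Variables (p : nat) (gT : finGroupType) (a1 a2 a3 a4 : gT).
Hypothesis rels_a : rels p a1 a2 a3 a4.

Definition mono3 (i j k : nat) : gT := a2 ^+ i * a3 ^+ j * a4 ^+ k.

Let cp1 : a1 ^+ p = 1. Proof. by case: rels_a => [[]]. Qed.
Let cp2 : a2 ^+ p = 1. Proof. by case: rels_a => [[]]. Qed.
Let cp3 : a3 ^+ p = 1. Proof. by case: rels_a => [[]]. Qed.
Let cp4 : a4 ^+ p = 1. Proof. by case: rels_a => [[]]. Qed.
Let J21 : a2 ^ a1 = a2 * a3.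
Proof. by case: rels_a => _ <- _ _; rewrite -conjg_mulR. Qed.
Let J31 : a3 ^ a1 = a3 * a4.
Proof. by case: rels_a => _ _ <- _; rewrite -conjg_mulR. Qed.
Let c32 : commute a3 a2. Proof. by case: rels_a => _ _ _ [_ /eqP/commgP]. Qed.
Let c42 : commute a4 a2. Proof. by case: rels_a => _ _ _ [_ _ /eqP/commgP]. Qed.
Let c43 : commute a4 a3.
Proof. by case: rels_a => _ _ _ [_ _ _ /eqP/commgP]. Qed.
Let c41 : commute a4 a1. Proof. by case: rels_a => _ _ _ [/eqP/commgP]. Qed.

Lemma mono3M i j k i' j' k' :
  mono3 i j k * mono3 i' j' k' = mono3 (i + i') (j + j') (k + k').
Proof.
rewrite /mono3 !expgD -!mulgA; congr (_ * _).
rewrite !(mulgA (a4 ^+ k)) (commuteX2 k i' c42) -!mulgA.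
rewrite (mulgA (a3 ^+ j)) (commuteX2 j i' c32) -!mulgA; do 2!congr (_ * _).
by rewrite !mulgA (commuteX2 k j' c43).
Qed.

Lemma mono3C i j k i' j' k' : commute (mono3 i j k) (mono3 i' j' k').
Proof.
rewrite /commute !mono3M.
by rewrite ![(i + _)%N]addnC ![(j + _)%N]addnC ![(k + _)%N]addnC.
Qed.

Lemma mono3_mod i j k : mono3 (i %% p) (j %% p) (k %% p) = mono3 i j k.
Proof. by rewrite /mono3 !expg_mod. Qed.

(** Pascal's rule: conjugation by a1 maps the exponents (i, j, k) to
    (i, j + i, k + j). *)
Lemma mono3J i j k u :
  mono3 i j k ^ (a1 ^+ u) = mono3 i (j + u * i) (k + u * j + 'C(u, 2) * i).
Proof.
elim: u => [|u IHu]; first by rewrite conjg1 !mul0n !addn0.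
rewrite expgSr conjgM IHu {IHu}; set j' := (j + _)%N; set k' := (k + _ + _)%N.
have ->: mono3 i j' k' ^ a1 = mono3 i (i + j') (j' + k').
  rewrite /mono3 !conjMg !conjXg J21 J31 (conjgE a4) c41 mulKg.
  rewrite (expgMn _ (esym c32)) (expgMn _ (esym c43)) -!mulgA -expgD.
  by rewrite !(mulgA (a3 ^+ _)) -expgD.
congr mono3; first by rewrite /j' mulSn addnCA.
rewrite /j' /k' binS bin1 !mulSn mulnDl; ring.
Qed.


Lemma mono3_1 : mono3 0 0 0 = 1. Proof. by rewrite /mono3 !mulg1. Qed.

(** The factor [mono3 i' j' k'] has no effect, since it commutes with all
    conjugates of [mono3 i j k] by powers of a1. *)
Lemma comm_mono3 i j k u i' j' k' :
  [~ mono3 i j k, a1 ^+ u * mono3 i' j' k']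
    = mono3 0 (u * i) (u * j + 'C(u, 2) * i).
Proof.
rewrite commgEl conjgM mono3J; apply: canLR (mulKg _) _.
by rewrite (conjgE _ (mono3 i' j' k')) mono3C mulKg mono3M addn0 addnA.
Qed.

Hypothesis p_pr : prime p.
Let p_gt0 : 0 < p := prime_gt0 p_pr.

Lemma mono3V i j k : (mono3 i j k)^-1 = mono3 (p.-1 * i) (p.-1 * j) (p.-1 * k).
Proof.
apply/eqP; rewrite eq_invg_mul mono3M -!mulSn prednK //.
by rewrite -mono3_mod !modnMr mono3_1.
Qed.

(** The normal forms contain the generators and are closed under products by
    [mono3J]; being finite, they form a subgroup, hence exhaust the generated
    group. *)
Definition normal_forms : {set gT} :=
  [set a1 ^+ w.1 * mono3 w.2.1.1 w.2.1.2 w.2.2 |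
    w : 'I_p * ('I_p * 'I_p * 'I_p)].

Lemma mem_normal_forms u i j k : a1 ^+ u * mono3 i j k \in normal_forms.
Proof.
pose o n := Ordinal (ltn_pmod n p_gt0); apply/imsetP.
by exists (o u, (o i, o j, o k)); rewrite // mono3_mod expg_mod.
Qed.

Lemma group_set_normal_forms : group_set normal_forms.
Proof.
apply/group_setP; split.
  by have:= mem_normal_forms 0 0 0 0; rewrite mono3_1 mulg1.
move=> _ _ /imsetP[[u m] _ ->] /imsetP[[u' m'] _ ->] /=.
have -> x y : a1 ^+ u * x * (a1 ^+ u' * y) = a1 ^+ (u + u') * (x ^ a1 ^+ u' * y).
  by rewrite expgD -!mulgA mulKVg.
by rewrite mono3J mono3M mem_normal_forms.
Qed.

Lemma normal_formP x : x \in <<[set a1; a2; a3; a4]>> ->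
  exists u i j k : 'I_p, x = a1 ^+ u * mono3 i j k.
Proof.
suff /subsetP sGN: <<[set a1; a2; a3; a4]>> \subset normal_forms.
  by move/sGN/imsetP=> [[u [[i j] k]] _ ->]; exists u, i, j, k.
rewrite (gen_subG _ (Group group_set_normal_forms)); apply/subsetP=> y /=.
rewrite !inE -!orbA => /or4P[] /eqP->.
- by have:= mem_normal_forms 1 0 0 0; rewrite mono3_1 mulg1.
- by have:= mem_normal_forms 0 1 0 0; rewrite /mono3 !mulg1 mul1g.
- by have:= mem_normal_forms 0 0 1 0; rewrite /mono3 mulg1 !mul1g.
by have:= mem_normal_forms 0 0 0 1; rewrite /mono3 !mul1g.
Qed.

(** The powers of a1 commute with each other, so expanding both arguments
    leaves only commutators to which [comm_mono3] applies. *)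
Lemma commutator_mono3 x y :
    x \in <<[set a1; a2; a3; a4]>> -> y \in <<[set a1; a2; a3; a4]>> ->
  exists j k, [~ x, y] = mono3 0 j k.
Proof.
move=> /normal_formP[w [i [j [k ->]]]] /normal_formP[u [i' [j' [k' ->]]]].
rewrite commMgJ comm_mono3 -[[~ a1 ^+ w, _]]invgR commMgJ.
have ->: [~ a1 ^+ u, a1 ^+ w] = 1 by apply/eqP/commgP/commuteX2.
rewrite conj1g mul1g -[a1 ^+ w]mulg1 -mono3_1 comm_mono3 mono3V.
rewrite conjgE mono3C mulKg mono3M muln0.
by do 2!eexists.
Qed.

(** When a4 is trivial, a3 is central. *)
Lemma class_le2 x y z :
    a4 = 1 -> x \in <<[set a1; a2; a3; a4]>> ->
    y \in <<[set a1; a2; a3; a4]>> -> z \in <<[set a1; a2; a3; a4]>> ->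
  [~ x, y, z] = 1.
Proof.
move=> a4_1 Gx Gy /normal_formP[u [i' [j' [k' ->]]]].
have [j [k ->]] := commutator_mono3 Gx Gy.
by rewrite comm_mono3 muln0 /mono3 a4_1 expg1n !mulg1.
Qed.

Hypothesis a4_neq1 : a4 != 1.

Lemma mono3_inj4 k k' : mono3 0 0 k = mono3 0 0 k' -> k = k' %[mod p].
Proof.
rewrite /mono3 !mul1g => /eqP.
by rewrite eq_expg_mod_order (nt_prime_order p_pr cp4 a4_neq1) => /eqP.
Qed.

(** Commutation with a1 shifts the exponents (i, j, k) to (0, i, j): applied
    twice it exhibits i, and applied once it exhibits j, as an exponent of a4. *)
Lemma mono3_inj i j k i' j' k' : mono3 i j k = mono3 i' j' k' ->
  [/\ i = i' %[mod p], j = j' %[mod p] & k = k' %[mod p]].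
Proof.
rewrite -mono3_mod -[RHS]mono3_mod => E.
have ad1 i0 j0 k0 : [~ mono3 i0 j0 k0, a1] = mono3 0 i0 j0.
  have:= comm_mono3 i0 j0 k0 1 0 0 0.
  by rewrite mono3_1 mulg1 !mul1n addn0.
have Ei : i = i' %[mod p].
  have := congr1 (fun x => [~ [~ x, a1], a1]) E; rewrite !ad1.
  by move/mono3_inj4; rewrite !modn_mod.
have Ej : j = j' %[mod p].
  have := congr1 (fun x => [~ x, a1]) E; rewrite !ad1 Ei /mono3 !mul1g.
  move/mulgI=> E4; have: mono3 0 0 (j %% p) = mono3 0 0 (j' %% p).
    by rewrite /mono3 E4.
  by move/mono3_inj4; rewrite !modn_mod.
split=> //; move: E; rewrite Ei Ej /mono3 => /mulgI E4.
have: mono3 0 0 (k %% p) = mono3 0 0 (k' %% p) by rewrite /mono3 E4.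
by move/mono3_inj4; rewrite !modn_mod.
Qed.

(** The a1-exponent is read off from the commutator with a3 = [mono3 0 1 0]. *)
Lemma normal_form_inj u i j k u' i' j' k' :
    a1 ^+ u * mono3 i j k = a1 ^+ u' * mono3 i' j' k' ->
  [/\ u = u' %[mod p], i = i' %[mod p], j = j' %[mod p] & k = k' %[mod p]].
Proof.
move=> E; have Eu : u = u' %[mod p].
  have := congr1 (fun x => [~ mono3 0 1 0, x]) E.
  by rewrite !comm_mono3 !muln0 !muln1 !addn0 => /mono3_inj4.
move: E; rewrite -(expg_mod u cp1) -(expg_mod u' cp1) Eu => /mulgI.
by case/mono3_inj.
Qed.

End Relations.

(** * A group of class 3 satisfying the relations

    The permutations (x, y) -> (x, y + f x) of the plane over 'F_p commute, and
    the commutator of such a map with the shift (x, y) -> (x + 1, y) is the one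
    attached to the backward difference f (x - 1) - f x.  Starting from
    f x = x ^+ 2, the second difference is the constant 2, and the third one
    vanishes. *)

Section ShearModel.

Variable p : nat.
Hypothesis p_pr : prime p.
Local Open Scope ring_scope.

Definition shear_fun (f : 'F_p -> 'F_p) (z : 'F_p * 'F_p) := (z.1, z.2 + f z.1).
Definition shift_fun (z : 'F_p * 'F_p) := (z.1 + 1, z.2).

Lemma shear_fun_inj f : injective (shear_fun f).
Proof.
apply: (can_inj (g := shear_fun (fun x => - f x))) => -[x y].
by rewrite /shear_fun /= GRing.addrK.
Qed.

Lemma shift_fun_inj : injective shift_fun.
Proof.
apply: (can_inj (g := fun z => (z.1 - 1, z.2))) => -[x y].
by rewrite /shift_fun /= GRing.addrK.
Qed.

Definition shear f : {perm 'F_p * 'F_p} := perm (@shear_fun_inj f).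
Definition shift : {perm 'F_p * 'F_p} := perm shift_fun_inj.

Lemma shearE f x y : shear f (x, y) = (x, y + f x).
Proof. by rewrite permE. Qed.

Lemma shiftE x y : shift (x, y) = (x + 1, y).
Proof. by rewrite permE. Qed.

Lemma eq_shear f g : f =1 g -> shear f = shear g.
Proof. by move=> E; apply/permP=> [[x y]]; rewrite !shearE E. Qed.

Lemma shearM f g : (shear f * shear g)%g = shear (fun x => f x + g x).
Proof. by apply/permP=> [[x y]]; rewrite permM !shearE GRing.addrA. Qed.

Lemma shear_comm f g : [~ shear f, shear g]%g = 1%g.
Proof.
apply/eqP/commgP; rewrite /commute !shearM.
by apply: eq_shear => x; rewrite GRing.addrC.
Qed.

Lemma shearR f : [~ shear f, shift]%g = shear (fun x => f (x - 1) - f x).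
Proof.
apply: canLR (mulKg _) _; rewrite shearM.
apply: canLR (mulKg _) _; apply/permP=> [[x y]].
by rewrite !permM !(shearE, shiftE) GRing.addrK (GRing.addrC (f (x + 1))) GRing.subrK.
Qed.

Lemma shearX f n : (shear f ^+ n)%g = shear (fun x => f x *+ n).
Proof.
elim: n => [|n IHn]; first by apply/permP=> [[x y]]; rewrite perm1 shearE GRing.addr0.
by rewrite expgS IHn shearM; apply: eq_shear => x; rewrite GRing.mulrS.
Qed.

Lemma shiftX n x y : (shift ^+ n)%g (x, y) = (x + n%:R, y).
Proof.
elim: n => [|n IHn]; first by rewrite perm1 GRing.addr0.
by rewrite expgSr permM IHn shiftE -GRing.addrA GRing.natr1.
Qed.

Definition sq (x : 'F_p) := x ^+ 2.
Definition dsq (x : 'F_p) := sq (x - 1) - sq x.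
Definition ddsq (x : 'F_p) := dsq (x - 1) - dsq x.

Lemma ddsqE x : ddsq x = 2%:R.
Proof. rewrite /ddsq /dsq /sq; ring. Qed.

Lemma rels_shear : rels p shift (shear sq) (shear dsq) (shear ddsq).
Proof.
have p0 (x : 'F_p) : x *+ p = 0 by rewrite -GRing.mulr_natr pchar_Fp_0 ?GRing.mulr0.
have shear0 (f : 'F_p -> 'F_p) : (forall x, f x = 0) -> shear f = 1%g.
  by move=> f0; apply/permP=> [[x y]]; rewrite shearE perm1 f0 GRing.addr0.
split; rewrite ?shearR ?shear_comm //; split=> //.
- by apply/permP=> [[x y]]; rewrite shiftX perm1 p0 GRing.addr0.
- by rewrite shearX; apply: shear0.
- by rewrite shearX; apply: shear0.
- by rewrite shearX; apply: shear0.
by apply: shear0 => x; rewrite !ddsqE GRing.subrr.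
Qed.

Lemma shear_ddsq_neq1 : (2 < p)%N -> shear ddsq != 1%g.
Proof.
move=> p_gt2; apply/eqP=> /permP/(_ (0, 0)).
rewrite shearE perm1 ddsqE GRing.add0r => /(congr1 snd) /= /eqP.
by rewrite -(GRing.dvdn_pcharf (pchar_Fp p_pr)) gtnNdvd.
Qed.

End ShearModel.

(** * The presented group is not of class 2 *)

(** If a4 were trivial then G, and hence its homomorphic image H, would satisfy
    [~ x, y, z] = 1, contradicting [~ s2, s1, s1] = s4 != 1 in the model. *)
Lemma presented_a4_neq1 p (gT : finGroupType) (G : {group gT}) (a1 a2 a3 a4 : gT) :
  prime p -> (2 < p)%N -> presented_by p G a1 a2 a3 a4 -> a4 != 1.
Proof.
move=> p_pr p_gt2 [isoG defG relG]; apply/eqP=> a4_1.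
pose s1 := shift p; pose s2 := shear (@sq p).
pose s3 := shear (@dsq p); pose s4 := shear (@ddsq p).
pose H := <[s1]> <*> <[s2]> <*> <[s3]> <*> <[s4]>.
have [[e1 e2 e3 e4] r21 r31 [r41 r32 r42 r43]] := rels_shear p_pr.
have /homgP[f fG] : H \homg G.
  rewrite isoG; apply/existsP; exists (s1, s2, s3, s4).
  by rewrite /= !xpair_eqE e1 e2 e3 e4 r21 r31 r41 r32 r42 r43 !eqxx.
have [Hs1 Hs2] : s1 \in H /\ s2 \in H.
  have sH34 x : x \in <[s1]> <*> <[s2]> -> x \in H.
    by move=> Hx; rewrite mem_gen // inE mem_gen // inE Hx.
  by split; apply: sH34; rewrite mem_gen // inE cycle_id ?orbT.
move: Hs1 Hs2; rewrite -{}fG => /morphimP[x1 _ Gx1 def1] /morphimP[x2 _ Gx2 def2].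
case/negP: (shear_ddsq_neq1 p_pr p_gt2); rewrite -r31 -r21 -/s1 -/s2 def1 def2.
rewrite -!morphR ?groupR // (class_le2 relG) ?defG //.
by rewrite morph1.
Qed.

(** * Automorphisms *)

Theorem mainTheorem6 (p : nat) (p_pr : prime p) (p_gt3 : (3 < p)%N)
    (gT : finGroupType) (G : {group gT}) (a1 a2 a3 a4 : gT)
    (presG : presented_by p G a1 a2 a3 a4)
    (alpha : {perm gT}) (autG : alpha \in Aut G) :
  exists! w : 'I_p * 'I_p * 'I_p * 'I_p * 'I_p * 'I_p * 'I_p,
    let: (u1, u2, u3, u4, v2, v3, v4) := w in
    ((u1 * v2)%N%:R != 0 :> 'F_p)%R
    /\ is_alpha a1 a2 a3 a4 u1 u2 u3 u4 v2 v3 v4 alpha.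
Proof.
have a4_neq1 := presented_a4_neq1 p_pr (ltnW p_gt3) presG.
have [_ defG rel_a] := presG.
have [_ r21 r31 [_ /eqP/commgP c32 _ _]] := rel_a.
have [Ga1 Ga2 Ga3 Ga4] : [/\ a1 \in G, a2 \in G, a3 \in G & a4 \in G].
  by rewrite -defG; split; rewrite mem_gen // !inE eqxx ?orbT.
have alphaR x y : x \in G -> y \in G -> alpha [~ x, y] = [~ alpha x, alpha y].
  by move=> Gx Gy; rewrite -(autmE autG) morphR.
have alphaG x : x \in G -> alpha x \in <<[set a1; a2; a3; a4]>>.
  by rewrite defG; apply: Aut_closed.
have alpha1 : alpha 1 = 1 by rewrite -(autmE autG) morph1.
have comm_m := comm_mono3 rel_a.
have m1 := mono3_1 a2 a3 a4.
have dvd_m4 k : (mono3 a2 a3 a4 0 0 k == 1) = (p %| k).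
  apply/eqP/idP=> [|/dvdnP[q ->]].
    by rewrite -m1 => /(mono3_inj4 rel_a p_pr a4_neq1)/eqP; rewrite mod0n.
  by rewrite -(mono3_mod rel_a) modnMl mod0n m1.
have [u1 [u2 [u3 [u4 Ea1]]]] :=
  normal_formP rel_a p_pr (alphaG _ Ga1).
have [w [v2 [v3 [v4 Ea2]]]] :=
  normal_formP rel_a p_pr (alphaG _ Ga2).
have Ea3 : alpha a3 = [~ alpha a2, alpha a1] by rewrite -r21 alphaR.
have Ea4 : alpha a4 = [~ alpha a3, alpha a1] by rewrite -r31 alphaR.
have alpha_a4_neq1 : alpha a4 != 1.
  by rewrite -alpha1 (inj_eq (@perm_inj _ alpha)).
have [j [k Ejk]] :=
  commutator_mono3 rel_a p_pr (alphaG _ Ga2) (alphaG _ Ga1).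
(* a3 commutes with a2, hence so do their images; this forces w = 0. *)
have w0 : w = 0%N :> nat.
  have p_wj : p %| w * j.
    rewrite -dvd_m4; have := comm_m 0 j k w v2 v3 v4.
    rewrite !muln0 addn0 => <-; rewrite -Ea2 -Ejk -Ea3 -alphaR //.
    by move/commgP/eqP: c32 => ->; rewrite alpha1.
  have p'j : ~~ (p %| j).
    apply: contra alpha_a4_neq1 => p_j.
    by rewrite Ea4 Ea3 Ejk Ea1 comm_m !muln0 addn0 dvd_m4 dvdn_mull.
  move: p_wj; rewrite Euclid_dvdM // (negPf p'j) orbF.
  by apply: contraTeq => w_neq0; rewrite gtnNdvd // lt0n.
rewrite Ea1 Ea2 w0 mul1g comm_m in Ea3; rewrite Ea3 Ea1 comm_m !muln0 addn0 in Ea4.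
rewrite w0 mul1g in Ea2.
have binE : ('C(u1, 2) * v2 = (u1 * (u1 - 1) * v2) %/ 2)%N.
  by rewrite bin2 -divn2 subn1 divn_mulAC // dvdn2 oddM; case: (nat_of_ord u1) => [|n] //=; rewrite andNb.
exists (u1, u2, u3, u4, v2, v3, v4); split=> [|[[[[[[u1' u2'] u3'] u4'] v2'] v3'] v4']].
  split.
    rewrite -(GRing.dvdn_pcharf (pchar_Fp p_pr)).
    apply: contra alpha_a4_neq1 => p_u1v2.
    by rewrite Ea4 dvd_m4 dvdn_mull.
  split; first by rewrite Ea1 /mono3 !mulgA.
  - exact: Ea2.
  - by rewrite Ea3 binE /mono3 mul1g.
  by rewrite Ea4 /mono3 !mul1g mulnA.
have ordE (x y : 'I_p) : x = y %[mod p] -> x = y.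
  by rewrite !modn_small //; apply: val_inj.
case=> _ [Ea1' Ea2' _ _].
have: a1 ^+ u1 * mono3 a2 a3 a4 u2 u3 u4 = a1 ^+ u1' * mono3 a2 a3 a4 u2' u3' u4'.
  by rewrite -Ea1 Ea1' /mono3 !mulgA.
case/(normal_form_inj rel_a p_pr a4_neq1).
do 4!move/ordE=> ->.
have [] := mono3_inj rel_a p_pr a4_neq1 (etrans (esym Ea2) Ea2').
by do 3!move/ordE=> ->.
Qed.
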